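(* Consider the Kalman smoothing data and the block tridiagonal system $Cx=r$ described in the context, where $C=H^{\mathrm T}R^{-1}H+G^{\mathrm T}Q^{-1}G$ and $r=H^{\mathrm T}R^{-1}z+G^{\mathrm T}Q^{-1}\zeta$. When applied to this system, the two filter block tridiagonal algorithm is equivalent to the Mayne-Fraser (MF) smoother. In particular, the MF smoothed estimates $\hat x_k$ can be written $$\hat x_k=(d_k^f+d_k^b-b_k)^{-1}(s_k^f+s_k^b-r_k),\qquad k=1,\dots,N.$$
   Context: **Data.** $N\ge 2$; $x_0\in\mathbb{R}^n$; $G_k\in\mathbb{R}^{n\times n}$ ($k=2,\dots,N$), $H_k\in\mathbb{R}^{m(k)\times n}$, $z_k\in\mathbb{R}^{m(k)}$, and symmetric positive definite $Q_k\in\mathbb{R}^{n\times n}$, $R_k\in\mathbb{R}^{m(k)\times m(k)}$ ($k=1,\dots,N$). These come from the linear Gaussian model $x_1=x_0+w_1$, $x_k=G_kx_{k-1}+w_k$ ($k\ge2$), $z_k=H_kx_k+v_k$, with $w_k,v_k$ independent zero-mean Gaussian with covariances $Q_k,R_k$. **System.** $Q,R,H$ are the block diagonal matrices with blocks $Q_k,R_k,H_k$; $G$ is block lower bidiagonal with identity diagonal blocks and $-G_k$ in block position $(k,k-1)$; $z=(z_1,\dots,z_N)$ and $\zeta=(x_0,0,\dots,0)$ stacked. Then $C$ is symmetric positive definite and block tridiagonal, with diagonal blocks $b_k=Q_k^{-1}+G_{k+1}^{\mathrm T}Q_{k+1}^{-1}G_{k+1}+H_k^{\mathrm T}R_k^{-1}H_k$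 (the term with index $N+1$ is zero), blocks $c_k=-Q_k^{-1}G_k$ in position $(k,k-1)$ and $c_k^{\mathrm T}$ in position $(k-1,k)$, $k=2,\dots,N$. Write $r_k$ for the blocks of $r$. **Two filter block tridiagonal algorithm.** Forward: $d_1^f=b_1$, $s_1^f=r_1$, and for $k=2,\dots,N$, $d_k^f=b_k-c_k(d_{k-1}^f)^{-1}c_k^{\mathrm T}$, $s_k^f=r_k-c_k(d_{k-1}^f)^{-1}s_{k-1}^f$. Backward: $d_N^b=b_N$, $s_N^b=r_N$, and for $k=N-1,\dots,1$, $d_k^b=b_k-c_{k+1}^{\mathrm T}(d_{k+1}^b)^{-1}c_{k+1}$, $s_k^b=r_k-c_{k+1}^{\mathrm T}(d_{k+1}^b)^{-1}s_{k+1}^b$. Output: $e_k=(d_k^f+d_k^b-b_k)^{-1}(s_k^f+s_k^b-r_k)$. **MF smoother.** Backward pass: write $Q_k=C_kC_k^{\mathrm T}$ with $C_k\in\mathbb{R}^{n\times n}$; set $P_N=H_N^{\mathrm T}R_N^{-1}H_N$, $\phi_N=-H_N^{\mathrm T}R_N^{-1}z_N$, $\Delta_k=[I+C_k^{\mathrm T}P_kC_k]^{-1}$, and for $k=N-1,\dots,1$ $$P_k=G_{k+1}^{\mathrm T}\big[I-P_{k+1}C_{k+1}\Delta_{k+1}C_{k+1}^{\mathrm T}\big]P_{k+1}G_{k+1}+H_k^{\mathrm T}R_k^{-1}H_k,$$ $$\phi_k=-H_k^{\mathrm T}R_k^{-1}z_k+G_{k+1}^{\mathrm T}\big[I-P_{k+1}C_{k+1}\Delta_{k+1}C_{k+1}^{\mathrm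 T}\big]\phi_{k+1}.$$ Forward pass (Kalman filter): $P_{1|0}=Q_1$, $x_{1|0}=x_0$; for $k\ge2$, $P_{k|k-1}=G_kP_{k-1|k-1}G_k^{\mathrm T}+Q_k$, $x_{k|k-1}=G_kx_{k-1|k-1}$; for $k\ge1$, $P_{k|k}^{-1}=P_{k|k-1}^{-1}+H_k^{\mathrm T}R_k^{-1}H_k$, $P_{k|k}^{-1}x_{k|k}=P_{k|k-1}^{-1}x_{k|k-1}+H_k^{\mathrm T}R_k^{-1}z_k$. Put $F_k=P_{k|k-1}^{-1}$ and $\gamma_k=-P_{k|k-1}^{-1}x_{k|k-1}$. The MF estimate is $$\hat x_k=-(P_k+F_k)^{-1}(\phi_k+\gamma_k),\qquad k=1,\dots,N.$$ *)

(* Defs.v *)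
From HB Require Import structures.
From mathcomp Require Import all_boot all_order all_algebra.
From mathcomp Require Import zify.
From mathcomp Require Import reals.

Set Implicit Arguments.
Unset Strict Implicit.
Unset Printing Implicit Defensive.

Import Order.TTheory GRing.Theory Num.Theory.
Local Open Scope ring_scope.

Definition posdefmx (R : realType) (n : nat) (A : 'M[R]_n) : Prop :=
  A \is symmetricmx /\
  (forall x : 'cV[R]_n, x != 0 -> 0 < (x^T *m A *m x) 0 0).

(* Time indices are the natural numbers 1, ..., N.  Sequences are total
   functions on nat; their values outside that range are never used (in
   particular Gk 1 is never used). *)

(* x_1 = a, x_k = f k x_(k-1) for k >= 2. *)
Definition fwd (T : Type) (a : T) (f : nat -> T -> T) (k : nat) : T :=
  iteri k.-1 (fun i => f i.+2) a.

(* x_N = a, x_k = f k x_(k+1) for 1 <= k < N. *)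
Definition bwd (T : Type) (N : nat) (a : T) (f : nat -> T -> T) (k : nat) : T :=
  iteri (N - k) (fun i => f (N - i.+1)%N) a.

Lemma fwd1 T (a : T) f : fwd a f 1 = a.
Proof. by []. Qed.

Lemma fwdS T (a : T) f k : (2 <= k)%N -> fwd a f k = f k (fwd a f k.-1).
Proof. by case: k => [|[|k]]. Qed.

Lemma bwdN T N (a : T) f : bwd N a f N = a.
Proof. by rewrite /bwd subnn. Qed.

Lemma bwdS T N (a : T) f k : (k < N)%N -> bwd N a f k = f k (bwd N a f k.+1).
Proof.
move=> ltkN; rewrite /bwd -(subnSK ltkN) /= subnSK //.
by rewrite subKn // ltnW.
Qed.

Record smoothing_data (R : realType) (n : nat) := SmoothingData {
  obs_dim : nat -> nat;
  x0 : 'cV[R]_n;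
  Gk : nat -> 'M[R]_n;
  Hk : forall k, 'M[R]_(obs_dim k, n);
  zk : forall k, 'cV[R]_(obs_dim k);
  Qk : nat -> 'M[R]_n;
  Rk : forall k, 'M[R]_(obs_dim k)
}.

(* In the block matrices below, position i : 'I_N carries time index i.+1. *)
Definition Hmx R n (D : smoothing_data R n) (N : nat) :
    'M[R]_(\sum_(i < N) obs_dim D i.+1, \sum_(i < N) n) :=
  \mxblock_(i < N, j < N) (if i == j then Hk D i.+1 else 0).

Definition Gmx R n (D : smoothing_data R n) (N : nat) :
    'M[R]_(\sum_(i < N) n) :=
  \mxblock_(i < N, j < N)
    (if i == j then 1%:M
     else if i == j.+1 :> nat then - Gk D i.+1 else 0).

Definition Qmx R n (D : smoothing_data R n) (N : nat) :
    'M[R]_(\sum_(i < N) n) :=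
  \mxdiag_(i < N) Qk D i.+1.

Definition Rmx R n (D : smoothing_data R n) (N : nat) :
    'M[R]_(\sum_(i < N) obs_dim D i.+1) :=
  \mxdiag_(i < N) Rk D i.+1.

Definition zvec R n (D : smoothing_data R n) (N : nat) :
    'cV[R]_(\sum_(i < N) obs_dim D i.+1) :=
  \mxcol_(i < N) zk D i.+1.

Definition zetavec R n (D : smoothing_data R n) (N : nat) :
    'cV[R]_(\sum_(i < N) n) :=
  \mxcol_(i < N) (if i == 0 :> nat then x0 D else 0).

Definition Cmx R n (D : smoothing_data R n) (N : nat) :
    'M[R]_(\sum_(i < N) n) :=
  (Hmx D N)^T *m invmx (Rmx D N) *m Hmx D N
  + (Gmx D N)^T *m invmx (Qmx D N) *m Gmx D N.

Definition rvec R n (D : smoothing_data R n) (N : nat) :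
    'cV[R]_(\sum_(i < N) n) :=
  (Hmx D N)^T *m invmx (Rmx D N) *m zvec D N
  + (Gmx D N)^T *m invmx (Qmx D N) *m zetavec D N.

(* Block (k, l) of A, and block k of v, counted from 1. *)
Definition blk (R : realType) (N n : nat) (A : 'M[R]_(\sum_(i < N) n))
    (k l : nat) : 'M[R]_n :=
  match (insub k.-1 : option 'I_N), (insub l.-1 : option 'I_N) with
  | Some i, Some j => submxblock A i j
  | _, _ => 0
  end.

Definition vblk (R : realType) (N n : nat) (v : 'cV[R]_(\sum_(i < N) n))
    (k : nat) : 'cV[R]_n :=
  if (insub k.-1 : option 'I_N) is Some i then submxcol v i else 0.

(* Two filter block tridiagonal algorithm for the symmetric system with
   diagonal blocks b, subdiagonal blocks c (c k in position (k, k-1)) and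
   right-hand side blocks r. *)
Definition dF (R : realType) n (b c : nat -> 'M[R]_n) : nat -> 'M[R]_n :=
  fwd (b 1%N) (fun k d => b k - c k *m invmx d *m (c k)^T).

Definition sF (R : realType) n (b c : nat -> 'M[R]_n) (r : nat -> 'cV[R]_n) :
    nat -> 'cV[R]_n :=
  fwd (r 1%N) (fun k s => r k - c k *m invmx (dF b c k.-1) *m s).

Definition dB (R : realType) n (N : nat) (b c : nat -> 'M[R]_n) :
    nat -> 'M[R]_n :=
  bwd N (b N) (fun k d => b k - (c k.+1)^T *m invmx d *m c k.+1).

Definition sB (R : realType) n (N : nat) (b c : nat -> 'M[R]_n)
    (r : nat -> 'cV[R]_n) : nat -> 'cV[R]_n :=
  bwd N (r N) (fun k s => r k - (c k.+1)^T *m invmx (dB N b c k.+1) *m s).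

Definition obs_info R n (D : smoothing_data R n) (k : nat) : 'M[R]_n :=
  (Hk D k)^T *m invmx (Rk D k) *m Hk D k.

Definition obs_vec R n (D : smoothing_data R n) (k : nat) : 'cV[R]_n :=
  (Hk D k)^T *m invmx (Rk D k) *m zk D k.

(* Mayne-Fraser backward pass.  Cf k is the factor in Q_k = C_k C_k^T, as
   opposed to the system matrix Cmx; DeltaInv is the matrix whose inverse is
   Delta_k, and MFgain is I - P_k C_k Delta_k C_k^T. *)
Definition DeltaInv (R : realType) n (Cf : nat -> 'M[R]_n) (k : nat)
    (P : 'M[R]_n) : 'M[R]_n :=
  1%:M + (Cf k)^T *m P *m Cf k.

Definition MFgain (R : realType) n (Cf : nat -> 'M[R]_n) (k : nat)
    (P : 'M[R]_n) : 'M[R]_n :=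
  1%:M - P *m Cf k *m invmx (DeltaInv Cf k P) *m (Cf k)^T.

Definition MFP R n (D : smoothing_data R n) (Cf : nat -> 'M[R]_n) (N : nat) :
    nat -> 'M[R]_n :=
  bwd N (obs_info D N)
    (fun k P =>
       (Gk D k.+1)^T *m MFgain Cf k.+1 P *m P *m Gk D k.+1 + obs_info D k).

Definition MFphi R n (D : smoothing_data R n) (Cf : nat -> 'M[R]_n) (N : nat) :
    nat -> 'cV[R]_n :=
  bwd N (- obs_vec D N)
    (fun k phi =>
       - obs_vec D k
       + (Gk D k.+1)^T *m MFgain Cf k.+1 (MFP D Cf N k.+1) *m phi).

(* Mayne-Fraser forward pass (Kalman filter): P_{k|k} as a function of
   P_{k|k-1}, then P_{k|k-1}, and similarly for x_{k|k} and x_{k|k-1}. *)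
Definition KFupdInfo R n (D : smoothing_data R n) (k : nat) (P : 'M[R]_n) :
    'M[R]_n :=
  invmx P + obs_info D k.

Definition KFPpred R n (D : smoothing_data R n) : nat -> 'M[R]_n :=
  fwd (Qk D 1)
    (fun k P =>
       Gk D k *m invmx (KFupdInfo D k.-1 P) *m (Gk D k)^T + Qk D k).

Definition KFP R n (D : smoothing_data R n) (k : nat) : 'M[R]_n :=
  invmx (KFupdInfo D k (KFPpred D k)).

Definition KFupdx R n (D : smoothing_data R n) (k : nat) (x : 'cV[R]_n) :
    'cV[R]_n :=
  KFP D k *m (invmx (KFPpred D k) *m x + obs_vec D k).

Definition KFxpred R n (D : smoothing_data R n) : nat -> 'cV[R]_n :=
  fwd (x0 D) (fun k x => Gk D k *m KFupdx D k.-1 x).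

Definition MFF R n (D : smoothing_data R n) (k : nat) : 'M[R]_n :=
  invmx (KFPpred D k).

Definition MFgamma R n (D : smoothing_data R n) (k : nat) : 'cV[R]_n :=
  - (invmx (KFPpred D k) *m KFxpred D k).

Definition MFestimate R n (D : smoothing_data R n) (Cf : nat -> 'M[R]_n)
    (N k : nat) : 'cV[R]_n :=
  - (invmx (MFP D Cf N k + MFF D k) *m (MFphi D Cf N k + MFgamma D k)).

Lemma posdefmx_unit (R : realType) n (A : 'M[R]_n) :
  posdefmx A -> A \in unitmx.
Proof.
move=> [_ Apos]; rewrite -row_free_unit; apply/inj_row_free => v vA0.
apply/eqP/negPn/negP => v_neq0.
have := Apos v^T; rewrite trmxK vA0 mul0mx mxE ltxx => H.
suff: false by [].
by apply: H; apply: contraNneq v_neq0 => /(congr1 trmx); rewrite trmxK trmx0 => ->.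
Qed.

Lemma invmx_mxdiag (R : realType) N (p_ : 'I_N -> nat)
    (B : forall i, 'M[R]_(p_ i)) :
  (forall i, B i \in unitmx) ->
  invmx (\mxdiag_i B i) = \mxdiag_i invmx (B i).
Proof.
move=> Bunit; have BK : (\mxdiag_i B i) *m (\mxdiag_i invmx (B i)) = 1%:M.
  rewrite mul_mxdiag_mxblock -[RHS]mxdiagZ; apply/eq_mxblock => i j.
  case: eqVneq => [eij|_]; last by rewrite mulmx0.
  by case: j / eij; rewrite !conform_mx_id mulmxV.
have [Du _] := mulmx1_unit BK.
by rewrite -[RHS](mulKmx Du) BK mulmx1.
Qed.

(* The blocks read off from Cmx and rvec are the block tridiagonal ones given
   by the closed formulas for b_k, c_k and r_k. *)
Section Blocks.
Variables (R : realType) (n : nat) (D : smoothing_data R n) (N : nat).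
Hypothesis Qpos : forall k, (1 <= k <= N)%N -> posdefmx (Qk D k).
Hypothesis Rpos : forall k, (1 <= k <= N)%N -> posdefmx (Rk D k).

Let g (i j : 'I_N) : 'M[R]_n :=
  if i == j then 1%:M else if i == j.+1 :> nat then - Gk D i.+1 else 0.

Lemma invQmx : invmx (Qmx D N) = \mxdiag_(i < N) invmx (Qk D i.+1).
Proof.
by apply: invmx_mxdiag => i; apply/posdefmx_unit/Qpos; rewrite ltn_ord.
Qed.

Lemma invRmx : invmx (Rmx D N) = \mxdiag_(i < N) invmx (Rk D i.+1).
Proof.
by apply: invmx_mxdiag => i; apply/posdefmx_unit/Rpos; rewrite ltn_ord.
Qed.

Lemma submxblock_Cmx i j :
  submxblock (Cmx D N) i j =
  (if i == j then obs_info D i.+1 else 0)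
  + \sum_l (g l i)^T *m invmx (Qk D l.+1) *m g l j.
Proof.
rewrite /Cmx submxblockD; congr (_ + _).
  rewrite invRmx /Hmx tr_mxblock mul_mxblock_mxdiag mul_mxblock mxblockK.
  case: eqVneq => [<-|nij].
    rewrite (bigD1 i) //= eqxx big1 ?addr0 // => l /negPf nli.
    by rewrite nli trmx0 mul0mx mul0mx.
  rewrite big1 // => l _; case: (eqVneq l i) => [eli|_]; last first.
    by rewrite trmx0 !mul0mx.
  by rewrite eli (negPf nij) mulmx0.
by rewrite invQmx /Gmx tr_mxblock mul_mxblock_mxdiag mul_mxblock mxblockK.
Qed.

Lemma submxcol_rvec i :
  submxcol (rvec D N) i =
  obs_vec D i.+1
  + \sum_l (g l i)^T *m invmx (Qk D l.+1)
              *m (if l == 0 :> nat then x0 D else 0).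
Proof.
rewrite /rvec submxcolD; congr (_ + _).
  rewrite invRmx /Hmx tr_mxblock mul_mxblock_mxdiag mul_mxblock_mxrow mxcolK.
  rewrite (bigD1 i) //= eqxx big1 ?addr0 // => l /negPf nli.
  by rewrite nli trmx0 mul0mx mul0mx.
by rewrite invQmx /Gmx tr_mxblock mul_mxblock_mxdiag mul_mxblock_mxrow mxcolK.
Qed.

Lemma blkE A (k l : nat) (i j : 'I_N) : k = i.+1 -> l = j.+1 ->
  blk A k l = submxblock A i j :> 'M[R]_n.
Proof. by move=> -> ->; rewrite /blk /= !valK. Qed.

Lemma vblkE v (k : nat) (i : 'I_N) : k = i.+1 ->
  vblk v k = submxcol v i :> 'cV[R]_n.
Proof. by move=> ->; rewrite /vblk /= valK. Qed.

Lemma Cmx_diag k : (1 <= k <= N)%N ->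
  blk (Cmx D N) k k =
  invmx (Qk D k)
  + (if (k < N)%N then (Gk D k.+1)^T *m invmx (Qk D k.+1) *m Gk D k.+1 else 0)
  + obs_info D k.
Proof.
case: k => // k ltkN; pose i := Ordinal (ltkN : (k < N)%N).
rewrite (@blkE _ _ _ i i) // submxblock_Cmx eqxx addrC; congr (_ + _).
rewrite (bigD1 i) //= /g eqxx trmx1 mul1mx mulmx1; congr (_ + _).
case: ifP => [ltk1|ltk1]; last first.
  rewrite big1 // => l /negPf nli; rewrite nli; case: eqP => [e|_].
    by move: (ltn_ord l); rewrite e /= ltk1.
  by rewrite trmx0 !mul0mx.
pose j := Ordinal ltk1; rewrite (bigD1 j) /=; last first.
  by rewrite -val_eqE /= gtn_eqF.
rewrite -val_eqE /= gtn_eqF // eqxx [(- _)^T]raddfN /= mulmxN !mulNmx opprK.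
rewrite big1 ?addr0 // => l /andP[/negPf nli nlj]; rewrite nli.
by rewrite -val_eqE /= in nlj; rewrite (negPf nlj) trmx0 !mul0mx.
Qed.

Lemma Cmx_subdiag k : (2 <= k <= N)%N ->
  blk (Cmx D N) k k.-1 = - (invmx (Qk D k) *m Gk D k).
Proof.
case: k => [|[|k]] // ltkN; pose i := Ordinal (ltkN : (k.+1 < N)%N).
pose j := Ordinal (ltnW ltkN : (k < N)%N).
rewrite (@blkE _ _ _ i j) // submxblock_Cmx -val_eqE /= gtn_eqF // add0r.
rewrite (bigD1 i) //= big1 ?addr0 => [|l nli].
  rewrite /g eqxx -!val_eqE /= gtn_eqF // eqxx trmx1 mul1mx.
  by rewrite mulmxN.
rewrite /g (negPf nli) -!val_eqE /=.
case: (nat_of_ord l =P k.+2) => [->|_]; last first.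
  by rewrite trmx0 !mul0mx.
by rewrite !gtn_eqF ?mulmx0 // ltnW.
Qed.

Lemma Cmx_far k l : (1 <= k <= N)%N -> (1 <= l <= N)%N ->
  (k.+1 < l)%N || (l.+1 < k)%N -> blk (Cmx D N) k l = 0.
Proof.
case: k l => // k [] // l ltkN ltlN.
pose i := Ordinal (ltkN : (k < N)%N); pose j := Ordinal (ltlN : (l < N)%N).
move=> far; have nkl : (k == l) = false by apply/eqP => e; move: far; rewrite e; lia.
rewrite (@blkE _ _ _ i j) // submxblock_Cmx -val_eqE /= nkl add0r.
rewrite big1 // => h _; rewrite /g -!val_eqE /=.
case: (nat_of_ord h =P k) => hk; case: (nat_of_ord h =P l) => hl;
  case: (nat_of_ord h =P k.+1) => hk'; case: (nat_of_ord h =P l.+1) => hl';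
  try lia; by rewrite ?trmx0 ?mulmx0 ?mul0mx.
Qed.

Lemma Cmx_superdiag k : (2 <= k <= N)%N ->
  blk (Cmx D N) k.-1 k = (blk (Cmx D N) k k.-1)^T.
Proof.
case: k => [|[|k]] // ltkN; pose i := Ordinal (ltkN : (k.+1 < N)%N).
pose j := Ordinal (ltnW ltkN : (k < N)%N).
rewrite (@blkE _ k.+1 k.+2 j i) // (@blkE _ k.+2 k.+1 i j) // !submxblock_Cmx.
rewrite -!val_eqE /= (@ltn_eqF k k.+1) // (@gtn_eqF k k.+1) // !add0r raddf_sum /=.
apply: eq_bigr => l _; rewrite !trmx_mul trmxK trmx_inv mulmxA.
have [/eqP Qsym _] : posdefmx (Qk D l.+1) by apply: Qpos; rewrite ltn_ord.
by rewrite expr0 scale1r map_mx_id // in Qsym; rewrite -Qsym.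
Qed.

Lemma rvec_blk k : (1 <= k <= N)%N ->
  vblk (rvec D N) k =
  obs_vec D k + (if k == 1%N then invmx (Qk D 1) *m x0 D else 0).
Proof.
case: k => // k ltkN; pose i := Ordinal (ltkN : (k < N)%N).
rewrite (@vblkE _ _ i) // submxcol_rvec; congr (_ + _).
pose o := Ordinal (leq_ltn_trans (leq0n k) ltkN).
rewrite (bigD1 o) //= big1 ?addr0 => [|l nlo]; last first.
  by rewrite -val_eqE /= in nlo; rewrite (negPf nlo) mulmx0.
rewrite /g -val_eqE /= eqSS eq_sym; case: eqP => _.
  by rewrite trmx1 mul1mx.
by rewrite trmx0 !mul0mx.
Qed.

End Blocks.

(* Main.v *)
Require Import Defs.
From mathcomp Require Import all_boot all_order all_algebra.
From mathcomp Require Import zify.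
From mathcomp Require Import reals.

Set Implicit Arguments.
Unset Strict Implicit.
Unset Printing Implicit Defensive.

Import Order.TTheory GRing.Theory Num.Theory.
Local Open Scope ring_scope.

(** Write U_k for the filtered information matrix [KFupdInfo] and T_k for the
    term G_(k+1)^T Q_(k+1)^-1 G_(k+1) of b_k (zero for k = N).  The forward
    block elimination is the Kalman filter in information form, and the backward
    one is the Mayne-Fraser backward pass, up to terms that belong to b_k and
    r_k:

      d_k^f = U_k + T_k = F_k + H_k^T R_k^-1 H_k + T_k,   d_k^b = Q_k^-1 + P_k,
      s_k^f = - gamma_k + H_k^T R_k^-1 z_k,               s_k^b = - phi_k,

    except that s_1^b also carries the prior term Q_1^-1 x_0 of r_1.  In
    d_k^f + d_k^b - b_k and s_k^f + s_k^b - r_k the extra terms cancel, which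
    leaves P_k + F_k and - (phi_k + gamma_k).

    These identities ([dF_KF], [sF_KF], [dB_MF], [sB_MF]) follow by induction
    along the recursions.  A forward step is the matrix inversion lemma, which
    rewrites the inverse of the covariance Q + G U^-1 G^T
    ([info_propagation], with its companion [info_gain]).  A backward step
    rests on I - P C Delta C^T = Q^-1 (Q^-1 + P)^-1 ([MFgain_info]), which
    also shows that Q may be used in place of its factor C.  All inverses exist
    because the matrices concerned are a positive definite one plus a positive
    semidefinite one; for the backward pass this needs P_k to be positive
    semidefinite ([MFP_psd]). *)

(** * Positive definite and semidefinite matrices *)

Definition psdmx (R : realType) (n : nat) (A : 'M[R]_n) : Prop :=
  A^T = A /\ (forall x : 'cV[R]_n, 0 <= (x^T *m A *m x) 0 0).

Lemma symmetricmxP (R : realType) n (A : 'M[R]_n) :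
  A \is symmetricmx <-> A^T = A.
Proof.
split=> [/eqP|As]; first by rewrite expr0 scale1r map_mx_id.
by apply/eqP; rewrite expr0 scale1r map_mx_id // As.
Qed.

Lemma posdefmx_tr (R : realType) n (A : 'M[R]_n) : posdefmx A -> A^T = A.
Proof. by move=> [/symmetricmxP]. Qed.

Lemma posdefmx_psd (R : realType) n (A : 'M[R]_n) : posdefmx A -> psdmx A.
Proof.
move=> [/symmetricmxP As Ap]; split=> // x.
have [->|x0] := eqVneq x 0; first by rewrite mulmx0 mxE.
by apply/ltW/Ap.
Qed.

Lemma posdefmxD (R : realType) n (A B : 'M[R]_n) :
  posdefmx A -> psdmx B -> posdefmx (A + B).
Proof.
move=> [/symmetricmxP As Ap] [Bs Bp]; split.
  by apply/symmetricmxP; rewrite linearD /= As Bs.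
by move=> x x0; rewrite mulmxDr mulmxDl mxE ltr_wpDr ?Ap ?Bp.
Qed.

Lemma psdmxD (R : realType) n (A B : 'M[R]_n) :
  psdmx A -> psdmx B -> psdmx (A + B).
Proof.
move=> [As Ap] [Bs Bp]; split; first by rewrite linearD /= As Bs.
by move=> x; rewrite mulmxDr mulmxDl mxE addr_ge0 ?Ap ?Bp.
Qed.

Lemma psdmx0 (R : realType) n : psdmx (0 : 'M[R]_n).
Proof. by split=> [|x]; rewrite ?trmx0 // mulmx0 mul0mx mxE. Qed.

Lemma psdmx_congr (R : realType) m n (A : 'M[R]_m) (B : 'M[R]_(m, n)) :
  psdmx A -> psdmx (B^T *m A *m B).
Proof.
move=> [As Ap]; split; first by rewrite !trmx_mul trmxK As mulmxA.
by move=> x; have := Ap (B *m x); rewrite trmx_mul !mulmxA.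
Qed.

Lemma posdefmx_inv (R : realType) n (A : 'M[R]_n) :
  posdefmx A -> posdefmx (invmx A).
Proof.
move=> Apd; have Au := posdefmx_unit Apd.
have As := posdefmx_tr Apd; case: Apd => _ Ap.
have Vs : (invmx A)^T = invmx A by rewrite trmx_inv As.
split=> [|x x0]; first exact/symmetricmxP.
(* The form of A^-1 at x is the form of A at A^-1 x. *)
have := Ap (invmx A *m x); rewrite trmx_mul Vs !mulmxA mulmxKV //; apply.
by apply: contraNneq x0 => /(congr1 (mulmx A)); rewrite mulKVmx // mulmx0 => ->.
Qed.

(** * One step of each recursion *)

(** The coefficient of the filtered information vector in the prediction step,
    in covariance form on the left and in information form on the right: both
    agree after clearing inverses, since
    G U^-1 (U + G^T Q^-1 G) = (Q + G U^-1 G^T) Q^-1 G. *)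
Lemma info_gain (F : comUnitRingType) m n (Q : 'M[F]_m) (U : 'M[F]_n)
    (G : 'M[F]_(m, n)) :
  Q \in unitmx -> U \in unitmx ->
  Q + G *m invmx U *m G^T \in unitmx ->
  U + G^T *m invmx Q *m G \in unitmx ->
  invmx (Q + G *m invmx U *m G^T) *m G *m invmx U
  = invmx Q *m G *m invmx (U + G^T *m invmx Q *m G).
Proof.
move=> Qu Uu Mu Wu.
set M := Q + _ in Mu *; set W := U + _ in Wu *.
apply: (canRL (mulmxK Wu)); rewrite -!mulmxA; apply: (canLR (mulKmx Mu)).
rewrite /M /W mulmxDr mulmxDl mulVmx // mulmxDr mulmx1 mulKVmx //.
by rewrite !mulmxA.
Qed.

(** The matrix inversion lemma, read as the prediction step of the information
    filter. *)
Lemma info_propagation (F : comUnitRingType) m n (Q : 'M[F]_m) (U : 'M[F]_n)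
    (G : 'M[F]_(m, n)) :
  Q \in unitmx -> U \in unitmx ->
  Q + G *m invmx U *m G^T \in unitmx ->
  U + G^T *m invmx Q *m G \in unitmx ->
  invmx (Q + G *m invmx U *m G^T)
  = invmx Q
    - invmx Q *m G *m invmx (U + G^T *m invmx Q *m G) *m G^T *m invmx Q.
Proof.
move=> Qu Uu Mu Wu; rewrite -info_gain //; set M := Q + _.
have -> : invmx M *m G *m invmx U *m G^T = invmx M *m (M - Q).
  by rewrite /M [Q + _]addrC addrK !mulmxA.
by rewrite mulmxBr mulVmx // mulmxBl mul1mx mulmxK // opprB addrC subrK.
Qed.

Section InfoGain.
Variables (R : realType) (n : nat) (Cf : nat -> 'M[R]_n) (k : nat).
Variables (Q P : 'M[R]_n).
Hypothesis Q_factor : Q = Cf k *m (Cf k)^T.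
Hypothesis Q_pos : posdefmx Q.
Hypothesis P_psd : psdmx P.

Let Q_unit : Q \in unitmx.
Proof. exact: posdefmx_unit. Qed.

Let Cf_unit : Cf k \in unitmx.
Proof. by move: Q_unit; rewrite Q_factor unitmx_mul => /andP[]. Qed.

Let S_pos : posdefmx (invmx Q + P).
Proof. exact/posdefmxD/P_psd/posdefmx_inv. Qed.

Let S_unit : invmx Q + P \in unitmx.
Proof. exact: posdefmx_unit. Qed.

Let CfT_unit : (Cf k)^T \in unitmx.
Proof. by rewrite unitmx_tr. Qed.

Let DeltaInvE : DeltaInv Cf k P = (Cf k)^T *m ((invmx Q + P) *m Cf k).
Proof.
rewrite mulmxA mulmxDr mulmxDl; congr (_ + _).
have -> : (Cf k)^T = invmx (Cf k) *m Q by rewrite Q_factor mulKmx.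
by rewrite mulmxK // mulVmx.
Qed.

Lemma DeltaInv_unit : DeltaInv Cf k P \in unitmx.
Proof. by rewrite DeltaInvE !unitmx_mul CfT_unit S_unit. Qed.

(** The factor C cancels: C Delta C^T is the inverse of Q^-1 + P, since
    Delta^-1 = C^T (Q^-1 + P) C. *)
Lemma MFgain_info : MFgain Cf k P = invmx Q *m invmx (invmx Q + P).
Proof.
have -> : invmx Q *m invmx (invmx Q + P) = 1%:M - P *m invmx (invmx Q + P).
  by apply/eqP; rewrite eq_sym subr_eq -mulmxDl mulmxV.
have DeltaE : (invmx Q + P) *m Cf k = invmx (Cf k)^T *m DeltaInv Cf k P.
  by rewrite DeltaInvE mulKmx.
rewrite /MFgain -!mulmxA; congr (_ - _ *m _).
rewrite -[RHS]mulmx1; apply: (canRL (mulKmx S_unit)).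
by rewrite [LHS]mulmxA DeltaE mulmxA mulmxK ?DeltaInv_unit // mulVmx.
Qed.

(** The form in which the backward block elimination meets the Mayne-Fraser
    step. *)
Lemma MFgain_mul :
  MFgain Cf k P *m P
  = invmx Q - invmx Q *m invmx (invmx Q + P) *m invmx Q.
Proof.
rewrite MFgain_info.
have {2}-> : P = (invmx Q + P) - invmx Q by rewrite addrC addKr.
by rewrite mulmxBr mulmxKV.
Qed.

(** The matrix is X^T (P + P Q P) X for X = (Q^-1 + P)^-1 Q^-1, because
    (P + P Q P) X = P. *)
Lemma MFgain_psd : psdmx (MFgain Cf k P *m P).
Proof.
have Qs := posdefmx_tr Q_pos; have [Ps _] := P_psd.
pose X := invmx (invmx Q + P) *m invmx Q.
have XT : X^T = MFgain Cf k P.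
  by rewrite MFgain_info /X trmx_mul !trmx_inv linearD /= trmx_inv Qs Ps.
have PX : (P + P *m Q *m P) *m X = P.
  have -> : P + P *m Q *m P = P *m Q *m (invmx Q + P).
    by rewrite mulmxDr mulmxK.
  by rewrite /X mulmxA mulmxK // mulmxK.
rewrite -XT -{1}PX mulmxA; apply: psdmx_congr; apply: psdmxD => //.
by rewrite -{1}Ps; apply/psdmx_congr/posdefmx_psd.
Qed.

End InfoGain.

(** * The block recursions as information filters *)

(** The information on x_k contained in the transition to x_(k+1). *)
Definition coupling (R : realType) n (D : smoothing_data R n) (k : nat) :
    'M[R]_n :=
  (Gk D k.+1)^T *m invmx (Qk D k.+1) *m Gk D k.+1.

(** T_k, which vanishes at the last time. *)
Definition next_coupling (R : realType) n (D : smoothing_data R n)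
    (N k : nat) : 'M[R]_n :=
  if (k < N)%N then coupling D k else 0.

(** The part of r_k that does not come from the observations. *)
Definition prior_vec (R : realType) n (D : smoothing_data R n) (k : nat) :
    'cV[R]_n :=
  if k == 1%N then invmx (Qk D 1) *m x0 D else 0.

Section TwoFilters.
Variables (R : realType) (N n : nat) (D : smoothing_data R n).
Variable Cf : nat -> 'M[R]_n.
Hypothesis Q_pos : forall k, (1 <= k <= N)%N -> posdefmx (Qk D k).
Hypothesis R_pos : forall k, (1 <= k <= N)%N -> posdefmx (Rk D k).
Hypothesis Cf_factor :
  forall k, (1 <= k <= N)%N -> Qk D k = Cf k *m (Cf k)^T.

Local Notation b := (fun k => blk (Cmx D N) k k).
Local Notation c := (fun k => blk (Cmx D N) k k.-1).
Local Notation r := (fun k => vblk (rvec D N) k).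

Let bE k : (1 <= k <= N)%N ->
  b k = invmx (Qk D k) + next_coupling D N k + obs_info D k.
Proof. exact: Cmx_diag. Qed.

Let cE k : (2 <= k <= N)%N -> c k = - (invmx (Qk D k) *m Gk D k).
Proof. exact: Cmx_subdiag. Qed.

Let cTE k : (2 <= k <= N)%N -> (c k)^T = - ((Gk D k)^T *m invmx (Qk D k)).
Proof.
move=> hk; have Qs : (Qk D k)^T = Qk D k by apply/posdefmx_tr/Q_pos; lia.
by rewrite cE // linearN /= trmx_mul trmx_inv Qs.
Qed.

Let rE k : (1 <= k <= N)%N -> r k = obs_vec D k + prior_vec D k.
Proof. exact: rvec_blk. Qed.

Lemma obs_info_psd k : (1 <= k <= N)%N -> psdmx (obs_info D k).
Proof. by move=> hk; apply/psdmx_congr/posdefmx_psd/posdefmx_inv/R_pos. Qed.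

Lemma next_coupling_psd k : (1 <= k <= N)%N -> psdmx (next_coupling D N k).
Proof.
rewrite /next_coupling => hk; case: ifP => ltkN; last exact: psdmx0.
by apply/psdmx_congr/posdefmx_psd/posdefmx_inv/Q_pos; lia.
Qed.

Lemma KFupdInfo_posdef k (P : 'M[R]_n) : (1 <= k <= N)%N ->
  posdefmx P -> posdefmx (KFupdInfo D k P).
Proof.
by move=> hk Ppos; apply: posdefmxD (posdefmx_inv Ppos) (obs_info_psd hk).
Qed.

Lemma KFPpredS k : (1 <= k)%N ->
  KFPpred D k.+1
  = Qk D k.+1
    + Gk D k.+1 *m invmx (KFupdInfo D k (KFPpred D k)) *m (Gk D k.+1)^T.
Proof. by move=> k1; rewrite {1}/KFPpred fwdS //= addrC. Qed.

Lemma KFPpred_posdef k : (1 <= k <= N)%N -> posdefmx (KFPpred D k).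
Proof.
elim: k => // k IHk hk; case: (posnP k) => [k0|k1].
  by rewrite k0; apply: Q_pos; lia.
have hk' : (1 <= k <= N)%N by lia.
rewrite KFPpredS //; apply: posdefmxD; first exact: Q_pos.
rewrite -{1}[Gk D k.+1]trmxK; apply/psdmx_congr/posdefmx_psd/posdefmx_inv.
exact/KFupdInfo_posdef/IHk.
Qed.

Let U k := KFupdInfo D k (KFPpred D k).

Let U_posdef k : (1 <= k <= N)%N -> posdefmx (U k).
Proof. by move=> hk; apply/KFupdInfo_posdef/KFPpred_posdef. Qed.

Let dF_S k : (1 <= k)%N ->
  dF b c k.+1 = b k.+1 - c k.+1 *m invmx (dF b c k) *m (c k.+1)^T.
Proof. by move=> k1; rewrite /dF fwdS. Qed.

Let sF_S k : (1 <= k)%N ->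
  sF b c r k.+1 = r k.+1 - c k.+1 *m invmx (dF b c k) *m sF b c r k.
Proof. by move=> k1; rewrite /sF fwdS. Qed.

Let pred_units k : (1 <= k < N)%N ->
  [/\ Qk D k.+1 \in unitmx, U k \in unitmx,
      Qk D k.+1 + Gk D k.+1 *m invmx (U k) *m (Gk D k.+1)^T \in unitmx
    & U k + coupling D k \in unitmx].
Proof.
move=> hk; have hk' : (1 <= k <= N)%N by lia.
have ltkN : (k < N)%N by lia.
split.
- exact/posdefmx_unit/Q_pos.
- exact/posdefmx_unit/U_posdef.
- rewrite -KFPpredS; last by lia.
  exact/posdefmx_unit/KFPpred_posdef.
- have := next_coupling_psd hk'; rewrite /next_coupling ltkN => Tpsd.
  exact/posdefmx_unit/posdefmxD/Tpsd/U_posdef.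
Qed.

(** The elimination step subtracts from Q_k^-1 exactly the correction that the
    matrix inversion lemma gives for the inverse of P_(k|k-1); the term T_(k-1)
    of d_(k-1)^f is what completes U_(k-1) to the matrix inverted there. *)
Lemma dF_KF k : (1 <= k <= N)%N ->
  dF b c k = KFupdInfo D k (KFPpred D k) + next_coupling D N k.
Proof.
elim: k => // k IHk hk; case: (posnP k) => [k0|k1].
  have h1 : (1 <= 1 <= N)%N by lia.
  by rewrite k0 /dF fwd1 (bE h1) addrAC.
have hk' : (1 <= k <= N)%N by lia.
have ltkN : (1 <= k < N)%N by lia.
have [Qu Uu Mu Wu] := pred_units ltkN.
rewrite dF_S // cTE // cE // bE // IHk // !mulNmx mulmxN opprK.
rewrite /KFupdInfo KFPpredS // info_propagation // /next_coupling.
have -> : (k < N)%N by lia.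
rewrite -!mulmxA -!addrA; congr (_ + _).
by rewrite addrA [RHS]addrC [_ + obs_info _ _]addrC.
Qed.

(** By [info_gain], elimination transports the filtered information vector as
    the prediction x_(k|k-1) = G_k x_(k-1|k-1) does. *)
Lemma sF_KF k : (1 <= k <= N)%N ->
  sF b c r k = invmx (KFPpred D k) *m KFxpred D k + obs_vec D k.
Proof.
elim: k => // k IHk hk; case: (posnP k) => [k0|k1].
  have h1 : (1 <= 1 <= N)%N by lia.
  by rewrite k0 /sF fwd1 (rE h1) /prior_vec eqxx addrC.
have hk' : (1 <= k <= N)%N by lia.
have ltkN : (1 <= k < N)%N by lia.
have [Qu Uu Mu Wu] := pred_units ltkN.
have xE : KFxpred D k.+1
    = Gk D k.+1 *m (invmx (U k)
        *m (invmx (KFPpred D k) *m KFxpred D k + obs_vec D k)).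
  by rewrite {1}/KFxpred fwdS.
rewrite sF_S // cE // rE // IHk // dF_KF // /prior_vec gtn_eqF // addr0.
rewrite xE KFPpredS // !mulNmx opprK addrC; congr (_ + _).
rewrite !mulmxA info_gain // /next_coupling.
by have -> : (k < N)%N by lia.
Qed.

Lemma MFP_S k : (k < N)%N ->
  MFP D Cf N k
  = (Gk D k.+1)^T *m MFgain Cf k.+1 (MFP D Cf N k.+1) *m MFP D Cf N k.+1
      *m Gk D k.+1
    + obs_info D k.
Proof. by move=> ltkN; rewrite {1}/MFP bwdS. Qed.

Lemma MFP_psd k : (1 <= k <= N)%N -> psdmx (MFP D Cf N k).
Proof.
move=> hk; have [d] := ubnP (N - k); elim: d k hk => // d IHd k hk ltd.
have [ltkN|leNk] := ltnP k N; last first.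
  have -> : k = N by lia.
  by rewrite /MFP bwdN; apply: obs_info_psd; lia.
rewrite (MFP_S ltkN); apply/psdmxD/obs_info_psd => //.
rewrite -[_ *m _ *m MFP D Cf N k.+1]mulmxA; apply/psdmx_congr.
have hk1 : (1 <= k.+1 <= N)%N by lia.
by apply: MFgain_psd (Cf_factor hk1) (Q_pos hk1) (IHd _ hk1 _); lia.
Qed.

(** By [MFgain_mul] the Mayne-Fraser step yields T_k minus the correction of the
    backward elimination.  As T_k is also a term of b_k, the two recursions
    differ by the term Q_k^-1 of b_k only. *)
Lemma dB_MF k : (1 <= k <= N)%N ->
  dB N b c k = invmx (Qk D k) + MFP D Cf N k.
Proof.
move=> hk; have [d] := ubnP (N - k); elim: d k hk => // d IHd k hk ltd.
have [ltkN|leNk] := ltnP k N; last first.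
  have -> : k = N by lia.
  by rewrite /dB /MFP !bwdN bE ?/next_coupling ?ltnn ?addr0 //; lia.
have hk1 : (1 <= k.+1 <= N)%N by lia.
have hk2 : (2 <= k.+1 <= N)%N by lia.
rewrite /dB bwdS // -/(dB N b c k.+1) IHd //; last by lia.
rewrite cTE // cE // bE // /next_coupling ltkN (MFP_S ltkN).
rewrite -[_ *m _ *m MFP D Cf N k.+1]mulmxA.
rewrite (MFgain_mul (Cf_factor hk1) (Q_pos hk1) (MFP_psd hk1)).
rewrite !mulNmx mulmxN opprK mulmxBr mulmxBl !mulmxA.
by rewrite -!addrA; congr (_ + (_ + _)); rewrite addrC.
Qed.

(** The prior term does not propagate: step k uses s_(k+1)^b with k + 1 >= 2,
    where it is zero. *)
Lemma sB_MF k : (1 <= k <= N)%N ->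
  sB N b c r k = prior_vec D k - MFphi D Cf N k.
Proof.
move=> hk; have [d] := ubnP (N - k); elim: d k hk => // d IHd k hk ltd.
have [ltkN|leNk] := ltnP k N; last first.
  have -> : k = N by lia.
  by rewrite /sB /MFphi !bwdN rE ?opprK 1?addrC //; lia.
have hk1 : (1 <= k.+1 <= N)%N by lia.
have hk2 : (2 <= k.+1 <= N)%N by lia.
rewrite /sB bwdS // -/(sB N b c r k.+1) IHd //; last by lia.
rewrite {2}/MFphi bwdS // -/(MFphi D Cf N k.+1).
rewrite (MFgain_info (Cf_factor hk1) (Q_pos hk1) (MFP_psd hk1)).
rewrite cTE // rE // dB_MF // {2}/prior_vec gtn_eqF ?add0r; last by lia.
rewrite !mulNmx mulmxN !opprK opprD opprK !mulmxA.
by rewrite addrA [prior_vec D k + _]addrC.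
Qed.

End TwoFilters.

Theorem mainTheorem9 (R : realType) (N n : nat) (D : smoothing_data R n)
    (Cf : nat -> 'M[R]_n)
    (N_ge2 : (2 <= N)%N)
    (Q_pos : forall k, (1 <= k <= N)%N -> posdefmx (Qk D k))
    (R_pos : forall k, (1 <= k <= N)%N -> posdefmx (Rk D k))
    (Cf_factor : forall k, (1 <= k <= N)%N -> Qk D k = Cf k *m (Cf k)^T) :
  let b k := blk (Cmx D N) k k in
  let c k := blk (Cmx D N) k k.-1 in
  let r k := vblk (rvec D N) k in
  forall k, (1 <= k <= N)%N ->
  [/\ (* every inverse taken by the two filter algorithm exists *)
      [/\ dF b c k \in unitmx,
          dB N b c k \in unitmx
        & dF b c k + dB N b c k - b k \in unitmx],
      (* every inverse taken by the Mayne-Fraser smoother exists *)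
      [/\ DeltaInv Cf k (MFP D Cf N k) \in unitmx,
          KFPpred D k \in unitmx,
          KFupdInfo D k (KFPpred D k) \in unitmx
        & MFP D Cf N k + MFF D k \in unitmx],
      (* both methods solve the same linear system at step k *)
      dF b c k + dB N b c k - b k = MFP D Cf N k + MFF D k,
      sF b c r k + sB N b c r k - r k = - (MFphi D Cf N k + MFgamma D k)
    & MFestimate D Cf N k =
        invmx (dF b c k + dB N b c k - b k)
        *m (sF b c r k + sB N b c r k - r k)].
Proof.
move=> b c r k hk.
have Ppos := KFPpred_posdef Q_pos R_pos hk.
have Upos := KFupdInfo_posdef R_pos hk Ppos.
have Mpsd := MFP_psd Q_pos R_pos Cf_factor hk.
have dFE : dF b c k = _ := dF_KF Q_pos R_pos hk.
have dBE : dB N b c k = _ := dB_MF Q_pos R_pos Cf_factor hk.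
have sFE : sF b c r k = _ := sF_KF Q_pos R_pos hk.
have sBE : sB N b c r k = _ := sB_MF Q_pos R_pos Cf_factor hk.
have bE : b k = invmx (Qk D k) + next_coupling D N k + obs_info D k.
  exact: Cmx_diag.
have rE : r k = obs_vec D k + prior_vec D k by exact: rvec_blk.
have PFpos : posdefmx (MFP D Cf N k + MFF D k).
  by rewrite addrC; apply: posdefmxD (posdefmx_inv Ppos) Mpsd.
have sumdE : dF b c k + dB N b c k - b k = MFP D Cf N k + MFF D k.
  apply/eqP; rewrite subr_eq dFE dBE bE /KFupdInfo /MFF addrA.
  by rewrite (ACl (5 * 1 * (4 * 3 * 2))).
have sumsE : sF b c r k + sB N b c r k - r k
    = - (MFphi D Cf N k + MFgamma D k).
  apply/eqP; rewrite subr_eq sFE sBE rE /MFgamma opprD opprK addrA.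
  by rewrite (ACl (4 * 1 * (2 * 3))).
split=> //.
- split; first by rewrite dFE; apply/posdefmx_unit/posdefmxD/next_coupling_psd.
    by rewrite dBE; apply/posdefmx_unit/posdefmxD/Mpsd/posdefmx_inv/Q_pos.
  by rewrite sumdE; apply: posdefmx_unit.
- split; try exact: posdefmx_unit.
  exact: DeltaInv_unit (Cf_factor _ hk) (Q_pos _ hk) Mpsd.
- by rewrite sumdE sumsE mulmxN.
Qed.
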